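(* Any object $(T_l,T_r,\Phi,\sqcap:\mathcal M\to\mathcal C,i,\sqcup:\mathcal D\to\mathcal M,w)$ of the category $\mathcal A$ determines a functor from $\mathcal D$ to the category of para-cocyclic objects in $\mathcal C$, sending an object $Y$ of $\mathcal D$ to the para-cocyclic object with degree $n$ part $\sqcap T_l^{n+1}\sqcup Y$ ($n\ge0$), and structure morphisms, for $0\le k\le n$, the components at $Y$ of $$d^k=\sqcap T_l^k u_l T_l^{n-k}\sqcup\ (n\ge 1),\qquad s^k=\sqcap T_l^k m_l T_l^{n-k}\sqcup,\qquad t^n=\sqcap T_l^n w\circ\sqcap\Phi^n\sqcup\circ iT_l^n\sqcup,$$ and sending a morphism $f$ of $\mathcal D$ to the family $(\sqcap T_l^{n+1}\sqcup f)_{n\ge0}$.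
   Context: Composition of functors is written by juxtaposition, $GvH$ denotes whiskering of a natural transformation $v$, and $\circ$ is vertical composition. $(T_l,m_l,u_l)$ and $(T_r,m_r,u_r)$ denote monads with their multiplications and units. A distributive law between monads $T_l,T_r$ on $\mathcal M$ is a natural transformation $\Phi:T_rT_l\to T_lT_r$ with $\Phi\circ m_rT_l=T_lm_r\circ\Phi T_r\circ T_r\Phi$, $\Phi\circ u_rT_l=T_lu_r$, $\Phi\circ T_rm_l=m_lT_r\circ T_l\Phi\circ\Phi T_l$, $\Phi\circ T_ru_l=u_lT_r$. An object of $\mathcal A$ is a septuple $(T_l,T_r,\Phi,\sqcap,i,\sqcup,w)$ where $T_l,T_r$ are monads on the same category $\mathcal M$; $\Phi:T_rT_l\to T_lT_r$ is a distributive law; $(\sqcap:\mathcal M\to\mathcal C,\ i:\sqcap T_l\to\sqcap T_r)$ is a right $\Phi$-module functor, i.e. $i$ is a natural transformation with $i\circ\sqcap m_l=\sqcap m_r\circ iT_r\circ\sqcap\Phi\circ iT_l$ and $i\circ\sqcap u_l=\sqcap u_r$; and $(\sqcup:\mathcal D\to\mathcal M,\ w:T_r\sqcup\to T_l\sqcup)$ is a left $\Phi$-module functor, i.e. $w$ is a natural transformation with $w\circ m_r\sqcup=m_l\sqcup\circ T_lw\circ\Phi\sqcup\circ T_rw$ and $w\circ u_r\sqcup=u_l\sqcup$. $\Phi^n:T_rT_l^n\to T_l^nT_r$ is defined by $\Phi^0=$ identity of $T_r$, $\Phi^1=\Phi$, $\Phi^n=T_l^{n-1}\Phi\circ\Phi^{n-1}T_l$.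 A para-cocyclic object in a category is a cosimplicial object $(Z^n)_{n\ge0}$ with cofaces $d^k:Z^{n-1}\to Z^n$ and codegeneracies $s^k:Z^{n+1}\to Z^n$ ($0\le k\le n$), together with morphisms $t^n:Z^n\to Z^n$ such that for $1\le k\le n$: $t^n\circ d^0=d^n$, $t^n\circ d^k=d^{k-1}\circ t^{n-1}$, $t^n\circ s^0=s^n\circ t^{n+1}\circ t^{n+1}$, $t^n\circ s^k=s^{k-1}\circ t^{n+1}$ (the relation for $d^0$ when $n\ge1$, that for $s^0$ when $n\ge0$). Morphisms are families $f^n:Z^n\to Z'^n$ compatible with cofaces, codegeneracies and $t$'s. *)

(* Defs.v *)
From mathcomp Require Import all_boot.
From mathcomp Require Import boolp.

Set Implicit Arguments.
Unset Strict Implicit.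
Unset Printing Implicit Defensive.

Declare Scope cat_scope.
Delimit Scope cat_scope with cat.
Local Open Scope cat_scope.

Record category := Category {
  ob :> Type;
  hom : ob -> ob -> Type;
  idm : forall a, hom a a;
  compm : forall a b c, hom b c -> hom a b -> hom a c;
  compmA : forall a b c d (h : hom c d) (g : hom b c) (f : hom a b),
    compm h (compm g f) = compm (compm h g) f;
  comp1m : forall a b (f : hom a b), compm (idm b) f = f;
  compm1 : forall a b (f : hom a b), compm f (idm a) = f }.

Arguments hom {_} _ _.
Arguments idm {_} _.
Notation "g ∘ f" := (compm g f) (at level 40, left associativity) : cat_scope.

Record prefunctor (C D : category) := Prefunctor {
  fob :> C -> D;
  fmap : forall a b, hom a b -> hom (fob a) (fob b) }.

Record functor (C D : category) := Functor {
  fdata :> prefunctor C D;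
  fmap1 : forall a, fmap fdata (idm a) = idm (fdata a);
  fmapM : forall a b c (g : hom b c) (f : hom a b),
    fmap fdata (g ∘ f) = fmap fdata g ∘ fmap fdata f }.

Definition functor_id (C : category) : functor C C :=
  @Functor C C (@Prefunctor C C (fun a => a) (fun _ _ f => f))
    (fun=> erefl) (fun _ _ _ _ _ => erefl).

Section FunctorComp.
Variables (C D E : category) (G : functor D E) (F : functor C D).

Let pre := @Prefunctor C E (fun a => G (F a)) (fun _ _ f => fmap G (fmap F f)).

Fact fcomp1 a : fmap pre (idm a) = idm (pre a).
Proof. by rewrite /= !fmap1. Qed.

Fact fcompM a b c (g : hom b c) (f : hom a b) :
  fmap pre (g ∘ f) = fmap pre g ∘ fmap pre f.
Proof. by rewrite /= !fmapM. Qed.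

Definition fcomp : functor C E := Functor fcomp1 fcompM.
End FunctorComp.

Record nattrans (C D : category) (F G : functor C D) := NatTrans {
  ncomp :> forall a, hom (F a) (G a);
  ncompP : forall a b (f : hom a b), fmap G f ∘ ncomp a = ncomp b ∘ fmap F f }.

(* Equations between natural transformations are stated on components: the
   component at [a] of the whiskering [G v H] is [fmap G (v (H a))]. *)

Record monad (M : category) := Monad {
  mfun :> functor M M;
  mmul : nattrans (fcomp mfun mfun) mfun;
  munit : nattrans (functor_id M) mfun;
  mmulA : forall a : M, mmul a ∘ mmul (mfun a) = mmul a ∘ fmap mfun (mmul a);
  mmul1l : forall a : M, mmul a ∘ munit (mfun a) = idm (mfun a);
  mmul1r : forall a : M, mmul a ∘ fmap mfun (munit a) = idm (mfun a) }.

Record distrlaw (M : category) (Tl Tr : monad M) := DistrLaw {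
  dlaw :> nattrans (fcomp Tr Tl) (fcomp Tl Tr);
  dlaw_mulr : forall a : M,
    dlaw a ∘ mmul Tr (Tl a)
      = fmap Tl (mmul Tr a) ∘ dlaw (Tr a) ∘ fmap Tr (dlaw a);
  dlaw_unitr : forall a : M,
    dlaw a ∘ munit Tr (Tl a) = fmap Tl (munit Tr a);
  dlaw_mull : forall a : M,
    dlaw a ∘ fmap Tr (mmul Tl a)
      = mmul Tl (Tr a) ∘ fmap Tl (dlaw a) ∘ dlaw (Tl a);
  dlaw_unitl : forall a : M,
    dlaw a ∘ fmap Tr (munit Tl a) = munit Tl (Tr a) }.

Record right_module (M C : category) (Tl Tr : monad M) (Phi : distrlaw Tl Tr)
    := RightModule {
  rmod :> functor M C;
  ract : nattrans (fcomp rmod Tl) (fcomp rmod Tr);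
  ract_mul : forall a : M,
    ract a ∘ fmap rmod (mmul Tl a)
      = fmap rmod (mmul Tr a) ∘ ract (Tr a) ∘ fmap rmod (Phi a) ∘ ract (Tl a);
  ract_unit : forall a : M,
    ract a ∘ fmap rmod (munit Tl a) = fmap rmod (munit Tr a) }.

Record left_module (D M : category) (Tl Tr : monad M) (Phi : distrlaw Tl Tr)
    := LeftModule {
  lmod :> functor D M;
  lact : nattrans (fcomp Tr lmod) (fcomp Tl lmod);
  lact_mul : forall y : D,
    lact y ∘ mmul Tr (lmod y)
      = mmul Tl (lmod y) ∘ fmap Tl (lact y) ∘ Phi (lmod y) ∘ fmap Tr (lact y);
  lact_unit : forall y : D,
    lact y ∘ munit Tr (lmod y) = munit Tl (lmod y) }.

(* The objects of the category A, over fixed D, M and C. *)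
Record septuple (D M C : category) := Septuple {
  Tl : monad M;
  Tr : monad M;
  Phi : distrlaw Tl Tr;
  sqcap : right_module C Phi;
  sqcup : left_module D Phi }.

(* Powers of an endofunctor, with [T^(n+1) = T^n T]. *)
Fixpoint fpow (M : category) (T : functor M M) (n : nat) : functor M M :=
  if n is n'.+1 then fcomp (fpow T n') T else functor_id M.

(* [T^m (T^n a)] and [T^(m+n) a] are equal, but not convertible; [eqhom] is the
   identity morphism between two such equal objects. *)
Definition eqhom (C : category) (a b : C) (e : a = b) : hom a b :=
  match e in _ = c return hom a c with erefl => idm a end.

Lemma fpowSl (M : category) (T : functor M M) n (a : M) :
  fpow T n.+1 a = T (fpow T n a).
Proof. by elim: n a => [//|n IHn] a; exact: IHn. Qed.

Lemma fpowD (M : category) (T : functor M M) m n (a : M) :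
  fpow T (m + n) a = fpow T m (fpow T n a).
Proof.
elim: m => [//|m IHm].
by rewrite addSn fpowSl IHm -fpowSl.
Qed.

Lemma fpow_split (M : category) (T : functor M M) p k n (a : M) : k <= n ->
  fpow T (p + n) a = fpow T k (fpow T p (fpow T (n - k) a)).
Proof.
by move=> le_kn; rewrite -(fpowD T p) -(fpowD T k) addnCA subnKC.
Qed.

(* The component at [a] of [T^k v T^(n-k) : T^(p+n) -> T^(q+n)], for
   [v : T^p -> T^q]. *)
Definition whisker (M : category) (T : functor M M) (p q : nat)
    (v : forall a : M, hom (fpow T p a) (fpow T q a))
    (k n : nat) (le_kn : k <= n) (a : M) :
    hom (fpow T (p + n) a) (fpow T (q + n) a) :=
  eqhom (esym (fpow_split T q a le_kn))
    ∘ fmap (fpow T k) (v (fpow T (n - k) a))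
    ∘ eqhom (fpow_split T p a le_kn).

Fixpoint dlaw_pow (M : category) (Tl Tr : monad M) (Phi : distrlaw Tl Tr)
    (n : nat) : forall a : M, hom (Tr (fpow Tl n a)) (fpow Tl n (Tr a)) :=
  match n return forall a : M, hom (Tr (fpow Tl n a)) (fpow Tl n (Tr a)) with
  | 0 => fun a => idm (Tr a)
  | n'.+1 => fun a => fmap (fpow Tl n') (Phi a) ∘ dlaw_pow Phi n' (Tl a)
  end.

(* In Z^n the degree is shifted so as to avoid predecessors: [coface n k] is
   d^k : Z^n -> Z^(n+1) for k = 0, ..., n+1, and [codeg n k] is
   s^k : Z^(n+1) -> Z^n for k = 0, ..., n. *)
Record pcdata (C : category) := PCData {
  pcob :> nat -> C;
  coface : forall n, 'I_n.+2 -> hom (pcob n) (pcob n.+1);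
  codeg : forall n, 'I_n.+1 -> hom (pcob n.+1) (pcob n);
  pcrot : forall n, hom (pcob n) (pcob n) }.

(* The index k, respectively k + 1, for k : 'I_n. *)
Definition ordw n (k : 'I_n) : 'I_n.+1 := widen_ord (leqnSn n) k.
Definition ords n (k : 'I_n) : 'I_n.+1 := lift ord0 k.

Record is_cosimplicial (C : category) (Z : pcdata C) : Prop := IsCosimplicial {
  coface_coface : forall n (i j : 'I_n.+2), i <= j ->
    coface Z (ords j) ∘ coface Z i = coface Z (ordw i) ∘ coface Z j;
  codeg_codeg : forall n (i j : 'I_n.+1), i <= j ->
    codeg Z j ∘ codeg Z (ordw i) = codeg Z i ∘ codeg Z (ords j);
  codeg_coface_lt : forall n (i : 'I_n.+2) (j : 'I_n.+1), i <= j ->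
    codeg Z (ords j) ∘ coface Z (ordw i) = coface Z i ∘ codeg Z j;
  codeg_coface_eq : forall n (j : 'I_n.+1),
    codeg Z j ∘ coface Z (ordw j) = idm (Z n);
  codeg_coface_succ : forall n (j : 'I_n.+1),
    codeg Z j ∘ coface Z (ords j) = idm (Z n);
  codeg_coface_gt : forall n (i : 'I_n.+2) (j : 'I_n.+1), j < i ->
    codeg Z (ordw j) ∘ coface Z (ords i) = coface Z i ∘ codeg Z j }.

Record is_paracocyclic (C : category) (Z : pcdata C) : Prop := IsParacocyclic {
  pc_cosimplicial : is_cosimplicial Z;
  pcrot_coface0 : forall n,
    pcrot Z n.+1 ∘ coface Z (@ord0 n.+1) = coface Z (@ord_max n.+1);
  pcrot_coface : forall n (k : 'I_n.+1),
    pcrot Z n.+1 ∘ coface Z (ords k) = coface Z (ordw k) ∘ pcrot Z n;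
  pcrot_codeg0 : forall n,
    pcrot Z n ∘ codeg Z (@ord0 n)
      = codeg Z (@ord_max n) ∘ pcrot Z n.+1 ∘ pcrot Z n.+1;
  pcrot_codeg : forall n (k : 'I_n),
    pcrot Z n ∘ codeg Z (ords k) = codeg Z (ordw k) ∘ pcrot Z n.+1 }.

Record is_pcmor (C : category) (Z Z' : pcdata C)
    (f : forall n, hom (Z n) (Z' n)) : Prop := IsPCMor {
  pcmor_coface : forall n (k : 'I_n.+2),
    f n.+1 ∘ coface Z k = coface Z' k ∘ f n;
  pcmor_codeg : forall n (k : 'I_n.+1),
    f n ∘ codeg Z k = codeg Z' k ∘ f n.+1;
  pcmor_rot : forall n, f n ∘ pcrot Z n = pcrot Z' n ∘ f n }.

Record pcobj (C : category) := PCObj {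
  pcobj_data :> pcdata C;
  pcobjP : is_paracocyclic pcobj_data }.

Record pcmor (C : category) (Z Z' : pcobj C) := PCMor {
  pcmor_fam :> forall n, hom (Z n) (Z' n);
  pcmorP : is_pcmor pcmor_fam }.

Section ParaCocyclicCategory.
Variable C : category.

Lemma pcmor_eq (Z Z' : pcobj C) (f g : pcmor Z Z') :
  (forall n, f n = g n) -> f = g.
Proof.
case: f g => [f fP] [g gP] /= fg.
have {}fg : f = g by exact: functional_extensionality_dep.
by case: _ / fg gP => gP; rewrite (Prop_irrelevance fP gP).
Qed.

Fact pcmor_id_subproof (Z : pcobj C) : is_pcmor (fun n => idm (Z n)).
Proof. by split=> *; rewrite comp1m compm1. Qed.

Definition pcmor_id Z : pcmor Z Z := PCMor (pcmor_id_subproof Z).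

Fact pcmor_comp_subproof (X Y Z : pcobj C) (g : pcmor Y Z) (f : pcmor X Y) :
  is_pcmor (fun n => g n ∘ f n).
Proof.
case: g f => g [gd gs gt] [f [fd fs ft]]; split=> *.
- by rewrite -compmA fd compmA gd compmA.
- by rewrite -compmA fs compmA gs compmA.
- by rewrite -compmA ft compmA gt compmA.
Qed.

Definition pcmor_comp X Y Z (g : pcmor Y Z) (f : pcmor X Y) : pcmor X Z :=
  PCMor (pcmor_comp_subproof g f).

Fact pcmor_compA X Y Z T (h : pcmor Z T) (g : pcmor Y Z) (f : pcmor X Y) :
  pcmor_comp h (pcmor_comp g f) = pcmor_comp (pcmor_comp h g) f.
Proof. by apply: pcmor_eq => n /=; rewrite compmA. Qed.

Fact pcmor_comp1m X Y (f : pcmor X Y) : pcmor_comp (pcmor_id Y) f = f.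
Proof. by apply: pcmor_eq => n /=; rewrite comp1m. Qed.

Fact pcmor_compm1 X Y (f : pcmor X Y) : pcmor_comp f (pcmor_id X) = f.
Proof. by apply: pcmor_eq => n /=; rewrite compm1. Qed.

Definition paracocyclic : category :=
  Category pcmor_compA pcmor_comp1m pcmor_compm1.
End ParaCocyclicCategory.

Section Construction.
Variables (D M C : category) (A : septuple D M C).
Let T : functor M M := Tl A.

Definition sept_ob (Y : D) (n : nat) : C := sqcap A (fpow T n.+1 (sqcup A Y)).

Definition sept_coface (Y : D) (n : nat) (k : 'I_n.+2) :
    hom (sept_ob Y n) (sept_ob Y n.+1) :=
  fmap (sqcap A)
    (@whisker M T 0 1 (munit (Tl A)) k n.+1 (leq_ord k) (sqcup A Y)).

Definition sept_codeg (Y : D) (n : nat) (k : 'I_n.+1) :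
    hom (sept_ob Y n.+1) (sept_ob Y n) :=
  fmap (sqcap A)
    (@whisker M T 2 1 (mmul (Tl A)) k n (leq_ord k) (sqcup A Y)).

Definition sept_rot (Y : D) (n : nat) : hom (sept_ob Y n) (sept_ob Y n) :=
  fmap (sqcap A) (fmap (fpow T n) (lact (sqcup A) Y))
    ∘ fmap (sqcap A) (dlaw_pow (Phi A) n (sqcup A Y))
    ∘ ract (sqcap A) (fpow T n (sqcup A Y))
    ∘ fmap (sqcap A) (eqhom (fpowSl T n (sqcup A Y))).

Definition sept_data (Y : D) : pcdata C :=
  PCData (@sept_coface Y) (@sept_codeg Y) (@sept_rot Y).

Definition sept_map (Y Y' : D) (f : hom Y Y') (n : nat) :
    hom (sept_data Y n) (sept_data Y' n) :=
  fmap (sqcap A) (fmap (fpow T n.+1) (fmap (sqcup A) f)).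
End Construction.

(* Main.v *)
Require Import Defs.
From mathcomp Require Import all_boot.
From mathcomp Require Import boolp.

(** A monad [T] makes the powers [T^(n+1) a] into a cosimplicial object: the unit
inserts a factor, the multiplication merges two. The rotation takes the leftmost
factor [T_l] of [T_l^(n+1) ⊔ Y], turns it into [T_r] by [i], carries it to the
right through the other [n] factors by [Phi^n], and turns it back into [T_l] by
[w]. A factor inserted, or a pair merged, away from the leftmost position is
therefore moved one place to the left: this holds because [Phi^n] commutes with
the units and multiplications of [T_l] ([dlaw_pow_insu], [dlaw_pow_insm]).
Inserting a factor at the leftmost position and rotating inserts it at the right
end, as [i], [Phi] and [w] respect the units of [T_l] and [T_r]. Merging the two
leftmost factors and rotating amounts to rotating both and merging them at the
right end: the module axiom of [i] opens [i] at a product into two copies of [i]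
with a [Phi] between them, the module axiom of [w] closes the corresponding
composite on the right ([lact_pow_mul]), and the [Phi] in the middle is the first
step of [Phi^(n+1)] ([peel_lact_pow]).

The formal difficulty is associativity: [T^k (T (T^(n-k) a))] and [T^(n+1) a]
are only provably equal, whereas [T^(n+1) a] and [T^n (T a)] are convertible.
Consequently all whiskered units and multiplications are described by recursion
on the right: at index [n] they are [T^n v_a], and at an index [k <= n] the one of
level [n+1] at [a] is the one of level [n] at [T a]. Each identity is then proved
by induction on the level for all [a] at once. The inductive step is the
induction hypothesis at [T a], and the base case, where the larger index is
maximal, is the naturality in [a] of the other factor or an axiom of the monad.
Only the rotation needs the leftmost factor, hence the transport [peel_fpow] from
[T^(n+1)] to [T T^n], whose interaction with each other morphism is settled once,
by the same induction. *)

Set Implicit Arguments.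
Unset Strict Implicit.
Unset Printing Implicit Defensive.
Local Open Scope cat_scope.

(** * Whiskered units and multiplications *)

(** The shape of the recursion on the right: the maximal index is the base case,
a smaller one comes from the level below. *)
Lemma leq_up_ind (P : nat -> nat -> Prop) :
    (forall n, P n n) -> (forall k n, k <= n -> P k n -> P k n.+1) ->
  forall k n, k <= n -> P k n.
Proof.
move=> Pnn PS k; elim=> [|n IHn]; first by rewrite leqn0 => /eqP->.
rewrite leq_eqVlt => /predU1P[->//|]; rewrite ltnS => le_kn.
by apply: PS => //; exact: IHn.
Qed.

Lemma eqhom_id (C : category) (a : C) (e : a = a) : eqhom e = idm a.
Proof. by rewrite (Prop_irrelevance e erefl). Qed.

(** The proofs that occur in a whiskering are immaterial: [n - k] may be replaced
by any equal [j] for which the transports become trivial. *)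
Lemma whiskerE (M : category) (T : functor M M) p q
    (v : forall a : M, hom (fpow T p a) (fpow T q a)) k n (le_kn : k <= n)
    (a : M) j (eq_j : n - k = j)
    (e : fpow T (p + n) a = fpow T k (fpow T p (fpow T j a)))
    (e' : fpow T k (fpow T q (fpow T j a)) = fpow T (q + n) a) :
  whisker v le_kn a = eqhom e' ∘ fmap (fpow T k) (v (fpow T j a)) ∘ eqhom e.
Proof.
case: j / eq_j e e' => e e'; rewrite /whisker.
by rewrite (Prop_irrelevance e (fpow_split T p a le_kn))
  (Prop_irrelevance e' (esym (fpow_split T q a le_kn))).
Qed.

Section Powers.
Variables (M : category) (T : functor M M).

(** The transport that separates the leftmost factor of [T^(n+1) a]. *)
Definition peel_fpow n (a : M) : hom (fpow T n.+1 a) (T (fpow T n a)) :=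
  eqhom (fpowSl T n a).

Lemma peel_fpow0 (a : M) : peel_fpow 0 a = idm (T a).
Proof. exact: eqhom_id. Qed.

(** The left-hand factor is out of reach of the recursion on the right, so peeling
at [a] is peeling at [T a]. *)
Lemma peel_fpowS n (a : M) : peel_fpow n.+1 a = peel_fpow n (T a).
Proof. by congr eqhom; exact: Prop_irrelevance. Qed.

Lemma peel_fpow_nat n (a b : M) (f : hom a b) :
  peel_fpow n b ∘ fmap (fpow T n.+1) f
    = fmap T (fmap (fpow T n) f) ∘ peel_fpow n a.
Proof.
elim: n a b f => [|n IHn] a b f; first by rewrite !peel_fpow0 comp1m compm1.
rewrite !peel_fpowS; exact: IHn.
Qed.
End Powers.

Section MonadWhiskers.
Variables (M : category) (T : monad M).

Notation Tn := (fpow T).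

(** [T^k u T^(n-k)] at [a], by recursion on the right, so that no transport
occurs; for [k > n] the value is that of [k = n]. *)
Fixpoint insu n k : forall a : M, hom (Tn n a) (Tn n.+1 a) :=
  match n with
  | 0 => fun a => munit T a
  | n'.+1 => fun a =>
    if k <= n' then insu n' k (T a) else fmap (Tn n'.+1) (munit T a)
  end.

(** Likewise [T^k m T^(n-k)] at [a]. *)
Fixpoint insm n k : forall a : M, hom (Tn n.+2 a) (Tn n.+1 a) :=
  match n with
  | 0 => fun a => mmul T a
  | n'.+1 => fun a =>
    if k <= n' then insm n' k (T a) else fmap (Tn n'.+1) (mmul T a)
  end.

Lemma insu_max n (a : M) : insu n n a = fmap (Tn n) (munit T a).
Proof. by case: n => //= n; rewrite ltnn. Qed.

Lemma insuS k n (a : M) : k <= n -> insu n.+1 k a = insu n k (T a).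
Proof. by move=> /= ->. Qed.

Lemma insm_max n (a : M) : insm n n a = fmap (Tn n) (mmul T a).
Proof. by case: n => //= n; rewrite ltnn. Qed.

Lemma insmS k n (a : M) : k <= n -> insm n.+1 k a = insm n k (T a).
Proof. by move=> /= ->. Qed.

Lemma whisker_munit k n (le_kn : k <= n) (a : M) :
  @whisker M T 0 1 (munit T) k n le_kn a = insu n k a.
Proof.
have le_kn0 := le_kn; move: k n le_kn0 le_kn a.
apply: leq_up_ind => [n|k n le_kn IHn] le_kn' a.
  rewrite insu_max (@whiskerE M T 0 1 _ _ _ _ _ 0 (subnn n) erefl erefl).
  by rewrite /= comp1m compm1.
rewrite insuS // -(IHn le_kn).
exact: (@whiskerE M T 0 1 _ _ _ _ _ (n - k).+1 (subSn le_kn)).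
Qed.

Lemma whisker_mmul k n (le_kn : k <= n) (a : M) :
  @whisker M T 2 1 (mmul T) k n le_kn a = insm n k a.
Proof.
have le_kn0 := le_kn; move: k n le_kn0 le_kn a.
apply: leq_up_ind => [n|k n le_kn IHn] le_kn' a.
  rewrite insm_max (@whiskerE M T 2 1 _ _ _ _ _ 0 (subnn n) erefl erefl).
  by rewrite /= comp1m compm1.
rewrite insmS // -(IHn le_kn).
exact: (@whiskerE M T 2 1 _ _ _ _ _ (n - k).+1 (subSn le_kn)).
Qed.

Lemma insu_nat k n (a b : M) (f : hom a b) : k <= n ->
  fmap (Tn n.+1) f ∘ insu n k a = insu n k b ∘ fmap (Tn n) f.
Proof.
move=> le_kn; move: k n le_kn a b f.
apply: leq_up_ind => [n|k n le_kn IHn] a b f.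
  by rewrite !insu_max -!(fmapM (Tn n));
    congr (fmap (Tn n) _); exact: (ncompP (munit T)).
rewrite !insuS //; exact: IHn.
Qed.

Lemma insm_nat k n (a b : M) (f : hom a b) : k <= n ->
  fmap (Tn n.+1) f ∘ insm n k a = insm n k b ∘ fmap (Tn n.+2) f.
Proof.
move=> le_kn; move: k n le_kn a b f.
apply: leq_up_ind => [n|k n le_kn IHn] a b f.
  by rewrite !insm_max -!(fmapM (Tn n));
    congr (fmap (Tn n) _); exact: (ncompP (mmul T)).
rewrite !insmS //; exact: IHn.
Qed.

(** Peeling lowers by one the index of an operation that does not touch the
leftmost factor; this lemma and the next make the naturality of the right action
applicable in the rotation. *)
Lemma peel_insu k n (a : M) : k <= n ->
  peel_fpow T n.+1 a ∘ insu n.+1 k.+1 a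
    = fmap T (insu n k a) ∘ peel_fpow T n a.
Proof.
move=> le_kn; move: k n le_kn a.
apply: leq_up_ind => [n|k n le_kn IHn] a.
  by rewrite !insu_max peel_fpowS; exact: peel_fpow_nat.
rewrite (@insuS k.+1) // (insuS _ le_kn) (peel_fpowS _ n.+1) (peel_fpowS _ n a).
exact: IHn.
Qed.

Lemma peel_insm k n (a : M) : k <= n ->
  peel_fpow T n.+1 a ∘ insm n.+1 k.+1 a
    = fmap T (insm n k a) ∘ peel_fpow T n.+2 a.
Proof.
move=> le_kn; move: k n le_kn a.
apply: leq_up_ind => [n|k n le_kn IHn] a.
  by rewrite !insm_max !peel_fpowS; exact: (peel_fpow_nat T n (mmul T a)).
rewrite (@insmS k.+1) // (insmS _ le_kn).
rewrite (peel_fpowS _ n.+1 a) (peel_fpowS _ n.+2 a).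
exact: IHn.
Qed.

(** At index [0] the operation becomes the unit, respectively the multiplication,
of the monad at [T^n a], to which the unit and module axioms of the right action
apply. *)
Lemma peel_insu0 n (a : M) : peel_fpow T n a ∘ insu n 0 a = munit T (Tn n a).
Proof.
elim: n a => [|n IHn] a; first by rewrite peel_fpow0 comp1m.
rewrite peel_fpowS; exact: IHn.
Qed.

Lemma peel_insm0 n (a : M) :
  peel_fpow T n a ∘ insm n 0 a
    = mmul T (Tn n a) ∘ fmap T (peel_fpow T n a) ∘ peel_fpow T n.+1 a.
Proof.
elim: n a => [|n IHn] a.
  by rewrite peel_fpowS !peel_fpow0 comp1m fmap1 !compm1.
by rewrite 2!peel_fpowS insmS //; exact: IHn.
Qed.

(** * The cosimplicial identities *)

Lemma insu_insu i j n (a : M) : i <= j -> j <= n ->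
  insu n.+1 j.+1 a ∘ insu n i a = insu n.+1 i a ∘ insu n j a.
Proof.
move=> le_ij le_jn; move: j n le_jn le_ij a.
apply: leq_up_ind => [n|j n le_jn IHn] le_ij a.
  by rewrite !insu_max insuS //; exact: insu_nat.
have le_in := leq_trans le_ij le_jn.
by rewrite !(insuS a) //; [exact: IHn | exact: leqW].
Qed.

Lemma insm_insm i j n (a : M) : i <= j -> j <= n ->
  insm n j a ∘ insm n.+1 i a = insm n i a ∘ insm n.+1 j.+1 a.
Proof.
move=> le_ij le_jn; move: j n le_jn le_ij a.
apply: leq_up_ind => [n|j n le_jn IHn] le_ij a; last first.
  have le_in := leq_trans le_ij le_jn.
  by rewrite !(insmS a) //; [exact: IHn | exact: leqW].
(* Associativity is used only when both indices are maximal; otherwise the two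
   products do not overlap and naturality suffices. *)
rewrite !insm_max insmS //.
case: n le_ij => [|n] le_in.
  move: le_in; rewrite leqn0 => /eqP->; exact: mmulA.
move: le_in; rewrite leq_eqVlt => /predU1P[->|].
  by rewrite !insm_max -!(fmapM (Tn n.+1)) mmulA.
rewrite ltnS => le_in; rewrite (insmS a) // (insmS (T a)) //.
exact: (insm_nat (mmul T a)).
Qed.

Lemma insm_insu_lt i j n (a : M) : i <= j -> j <= n ->
  insm n.+1 j.+1 a ∘ insu n.+2 i a = insu n.+1 i a ∘ insm n j a.
Proof.
move=> le_ij le_jn; move: j n le_jn le_ij a.
apply: leq_up_ind => [n|j n le_jn IHn] le_ij a.
  rewrite !insm_max !(insuS a) 1?leqW // (insuS (T a)) //.
  exact: (insu_nat (mmul T a)).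
have le_in := leq_trans le_ij le_jn.
by rewrite !(insuS a) ?leqW // !(insmS a) //; exact: IHn.
Qed.

Lemma insm_insu_eq j n (a : M) : j <= n ->
  insm n j a ∘ insu n.+1 j a = idm (Tn n.+1 a).
Proof.
move=> le_jn; move: j n le_jn a.
apply: leq_up_ind => [n|j n le_jn IHn] a.
  by rewrite insm_max insuS // insu_max -(fmapM (Tn n)) mmul1l fmap1.
by rewrite insmS // insuS ?leqW //; exact: IHn.
Qed.

Lemma insm_insu_succ j n (a : M) : j <= n ->
  insm n j a ∘ insu n.+1 j.+1 a = idm (Tn n.+1 a).
Proof.
move=> le_jn; move: j n le_jn a.
apply: leq_up_ind => [n|j n le_jn IHn] a.
  by rewrite insm_max insu_max -(fmapM (Tn n)) mmul1r fmap1.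
by rewrite insmS // insuS //; exact: IHn.
Qed.

Lemma insm_insu_gt i j n (a : M) : j < i -> i <= n.+1 ->
  insm n.+1 j a ∘ insu n.+2 i.+1 a = insu n.+1 i a ∘ insm n j a.
Proof.
elim: n a => [|n IHn] a lt_ji.
- case: i lt_ji => [|[|//]] //; rewrite ltnS leqn0 => /eqP-> _.
  by rewrite insmS // !insu_max -insm_nat.
- rewrite leq_eqVlt => /predU1P[i_max|].
    by rewrite i_max in lt_ji *; rewrite insmS // !insu_max -insm_nat.
  rewrite ltnS => le_in; have le_jn : j <= n by rewrite -ltnS (leq_trans lt_ji).
  by rewrite (insmS a) ?leqW // !(insuS a) // (insmS a le_jn); exact: IHn.
Qed.
End MonadWhiskers.

(** * Powers of the distributive law *)

Section DistributiveLawPowers.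
Variables (M : category) (Tl Tr : monad M) (Phi : distrlaw Tl Tr).

Notation Tn := (fpow Tl).
Notation Phin := (dlaw_pow Phi).

Lemma dlaw_powS n (a : M) :
  Phin n.+1 a = fmap (Tn n) (Phi a) ∘ Phin n (Tl a).
Proof. by []. Qed.

Lemma dlaw_pow_nat n (a b : M) (f : hom a b) :
  fmap (Tn n) (fmap Tr f) ∘ Phin n a = Phin n b ∘ fmap Tr (fmap (Tn n) f).
Proof.
elim: n a b f => [|n IHn] a b f; first by rewrite /= comp1m compm1.
have nat_f : fmap Tl (fmap Tr f) ∘ Phi a = Phi b ∘ fmap Tr (fmap Tl f).
  exact: (ncompP Phi).
rewrite /= compmA -(fmapM (Tn n)) nat_f fmapM -!compmA.
by congr (_ ∘ _); exact: IHn.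
Qed.

(** With the next lemma: [Phi^n] is a distributive law of [T_r] over the
endofunctor [T_l^n]. *)
Lemma dlaw_pow_unitr n (a : M) :
  Phin n a ∘ munit Tr (Tn n a) = fmap (Tn n) (munit Tr a).
Proof.
elim: n a => [|n IHn] a /=; first by rewrite comp1m.
by rewrite -compmA IHn -fmapM dlaw_unitr.
Qed.

Lemma dlaw_pow_mulr n (a : M) :
  Phin n a ∘ mmul Tr (Tn n a)
    = fmap (Tn n) (mmul Tr a) ∘ Phin n (Tr a) ∘ fmap Tr (Phin n a).
Proof.
elim: n a => [|n IHn] a /=; first by rewrite fmap1 comp1m !compm1.
rewrite -compmA IHn !compmA -(fmapM (Tn n)) dlaw_mulr !fmapM -!compmA.
do 2 congr (_ ∘ _); rewrite !compmA; congr (_ ∘ _).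
exact: dlaw_pow_nat.
Qed.

(** With the next lemma: [T_r] slides past the units and products of [T_l], one
crossing fewer being left after a unit and one more after a product. *)
Lemma dlaw_pow_insu k n (a : M) : k <= n ->
  Phin n.+1 a ∘ fmap Tr (insu Tl n k a) = insu Tl n k (Tr a) ∘ Phin n a.
Proof.
move=> le_kn; move: k n le_kn a.
apply: leq_up_ind => [n|k n le_kn IHn] a.
  rewrite !insu_max -(dlaw_unitl Phi) fmapM -[RHS]compmA.
  by rewrite (dlaw_pow_nat n (munit Tl a)) compmA.
rewrite !insuS // [LHS]/= -compmA IHn compmA.
by rewrite (insu_nat Tl (Phi a) le_kn) -compmA.
Qed.

Lemma dlaw_pow_insm k n (a : M) : k <= n ->
  Phin n.+1 a ∘ fmap Tr (insm Tl n k a) = insm Tl n k (Tr a) ∘ Phin n.+2 a.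
Proof.
move=> le_kn; move: k n le_kn a.
apply: leq_up_ind => [n|k n le_kn IHn] a.
  rewrite !insm_max /= -compmA -(dlaw_pow_nat n (mmul Tl a)) [LHS]compmA.
  by rewrite -(fmapM (Tn n)) (dlaw_mull Phi) !fmapM -!compmA.
rewrite !insmS // [LHS]/= -compmA IHn compmA.
by rewrite (insm_nat Tl (Phi a) le_kn) -compmA.
Qed.

(** [dlaw_pow] splits off its last crossing, at the right; this is the
decomposition that splits off the first one, at the left. *)
Lemma peel_dlaw_pow n (a : M) :
  peel_fpow Tl n (Tr a) ∘ Phin n.+1 a
    = fmap Tl (Phin n a) ∘ Phi (Tn n a) ∘ fmap Tr (peel_fpow Tl n a).
Proof.
elim: n a => [|n IHn] a; first by rewrite /= !peel_fpow0 !fmap1 !(comp1m, compm1).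
have nat_Phi : peel_fpow Tl n (Tl (Tr a)) ∘ fmap (Tn n.+1) (Phi a)
    = fmap Tl (fmap (Tn n) (Phi a)) ∘ peel_fpow Tl n (Tr (Tl a)).
  exact: (peel_fpow_nat Tl n (Phi a)).
rewrite (dlaw_powS n.+1) compmA (peel_fpowS _ _ (Tr a)) nat_Phi.
rewrite -[LHS]compmA IHn !compmA -fmapM.
by rewrite peel_fpowS.
Qed.
End DistributiveLawPowers.

(** * The right-hand half of the rotation *)

Section LeftModule.
Variables (D M : category) (Tl Tr : monad M) (Phi : distrlaw Tl Tr).
Variables (N : left_module D Phi) (Y : D).

Notation Tn := (fpow Tl).

(** The part of the rotation after the right action: [T_r] crosses [n] factors and
is then absorbed as a new rightmost factor [T_l]. *)
Definition lact_pow n : hom (Tr (Tn n (N Y))) (Tn n.+1 (N Y)) :=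
  fmap (Tn n) (lact N Y) ∘ dlaw_pow Phi n (N Y).

Lemma lact_pow_unit n :
  lact_pow n ∘ munit Tr (Tn n (N Y)) = insu Tl n n (N Y).
Proof.
rewrite /lact_pow -compmA dlaw_pow_unitr -(fmapM (Tn n)) (lact_unit N).
by rewrite insu_max.
Qed.

Lemma lact_pow_insu k n : k <= n ->
  lact_pow n.+1 ∘ fmap Tr (insu Tl n k (N Y))
    = insu Tl n.+1 k (N Y) ∘ lact_pow n.
Proof.
move=> le_kn; rewrite /lact_pow -compmA dlaw_pow_insu // compmA.
by rewrite (insu_nat Tl (lact N Y) le_kn) insuS // -[LHS]compmA.
Qed.

Lemma lact_pow_insm k n : k <= n ->
  lact_pow n.+1 ∘ fmap Tr (insm Tl n k (N Y))
    = insm Tl n.+1 k (N Y) ∘ lact_pow n.+2.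
Proof.
move=> le_kn; rewrite /lact_pow -compmA dlaw_pow_insm // compmA.
by rewrite (insm_nat Tl (lact N Y) le_kn) insmS // -[LHS]compmA.
Qed.

Lemma peel_lact_pow n :
  peel_fpow Tl n.+1 (N Y) ∘ lact_pow n.+1
    = fmap Tl (lact_pow n) ∘ Phi (Tn n (N Y)) ∘ fmap Tr (peel_fpow Tl n (N Y)).
Proof.
rewrite /lact_pow compmA peel_fpowS (peel_fpow_nat Tl n (lact N Y)) -[LHS]compmA.
by rewrite peel_dlaw_pow fmapM !compmA.
Qed.

(** The axiom of the left module with [n] factors [T_l] in between: moving a
product in [T_r] to the right is moving its factors one after the other and
multiplying in [T_l]. *)
Lemma lact_pow_mul n :
  lact_pow n ∘ mmul Tr (Tn n (N Y))
    = insm Tl n n (N Y) ∘ lact_pow n.+1 ∘ fmap Tr (lact_pow n).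
Proof.
rewrite /lact_pow -[LHS]compmA (dlaw_pow_mulr Phi) insm_max dlaw_powS fmapM.
rewrite !compmA -(fmapM (Tn n)) (lact_mul N) !(fmapM (Tn n)).
rewrite -!compmA; do 3 congr (_ ∘ _).
rewrite !compmA; congr (_ ∘ _); exact: (dlaw_pow_nat Phi n (lact N Y)).
Qed.
End LeftModule.

Lemma lact_pow_nat (D M : category) (Tl Tr : monad M) (Phi : distrlaw Tl Tr)
    (N : left_module D Phi) n (Y Y' : D) (f : hom Y Y') :
  fmap (fpow Tl n.+1) (fmap N f) ∘ lact_pow N Y n
    = lact_pow N Y' n ∘ fmap Tr (fmap (fpow Tl n) (fmap N f)).
Proof.
have nat_f : fmap Tl (fmap N f) ∘ lact N Y = lact N Y' ∘ fmap Tr (fmap N f).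
  exact: (ncompP (lact N)).
rewrite /lact_pow compmA -(fmapM (fpow Tl n)) nat_f (fmapM (fpow Tl n)).
rewrite -[LHS]compmA -[RHS]compmA; congr (_ ∘ _).
exact: (dlaw_pow_nat Phi n (fmap N f)).
Qed.

(** * The para-cocyclic object *)

Section ParaCocyclicObject.
Variables (D M C : category) (A : septuple D M C) (Y : D).

Notation T := (Defs.Tl A).
Notation R := (Defs.Tr A).
Notation G := (sqcap A).
Notation N := (sqcup A).

Lemma ract_nat (a b : M) (f : hom a b) :
  ract G b ∘ fmap G (fmap T f) = fmap G (fmap R f) ∘ ract G a.
Proof. by rewrite -(ncompP (ract G)). Qed.

Lemma sept_cofaceE n (k : 'I_n.+2) :
  sept_coface A Y k = fmap G (insu T n.+1 k (N Y)).
Proof. by rewrite /sept_coface whisker_munit. Qed.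

Lemma sept_codegE n (k : 'I_n.+1) :
  sept_codeg A Y k = fmap G (insm T n k (N Y)).
Proof. by rewrite /sept_codeg whisker_mmul. Qed.

Lemma sept_rotE n :
  sept_rot A Y n
    = fmap G (lact_pow N Y n) ∘ ract G (fpow T n (N Y))
        ∘ fmap G (peel_fpow T n (N Y)).
Proof. by rewrite /lact_pow fmapM. Qed.

Lemma sept_rot_insu0 n :
  sept_rot A Y n.+1 ∘ fmap G (insu T n.+1 0 (N Y))
    = fmap G (insu T n.+1 n.+1 (N Y)).
Proof.
rewrite sept_rotE -!compmA -!(fmapM G) peel_insu0 (ract_unit G) -(fmapM G).
congr (fmap G _); exact: (lact_pow_unit N Y n.+1).
Qed.

Lemma sept_rot_insu k n : k <= n ->
  sept_rot A Y n.+1 ∘ fmap G (insu T n.+1 k.+1 (N Y))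
    = fmap G (insu T n.+1 k (N Y)) ∘ sept_rot A Y n.
Proof.
move=> le_kn; rewrite !sept_rotE -[LHS]compmA -(fmapM G) peel_insu // (fmapM G).
rewrite !compmA -[X in X ∘ _ = _]compmA ract_nat !compmA -!(fmapM G).
by rewrite lact_pow_insu.
Qed.

Lemma sept_rot_insm k n : k <= n ->
  sept_rot A Y n.+1 ∘ fmap G (insm T n.+1 k.+1 (N Y))
    = fmap G (insm T n.+1 k (N Y)) ∘ sept_rot A Y n.+2.
Proof.
move=> le_kn; rewrite !sept_rotE -[LHS]compmA -(fmapM G) peel_insm // (fmapM G).
rewrite !compmA -[X in X ∘ _ = _]compmA ract_nat !compmA -!(fmapM G).
by rewrite lact_pow_insm.
Qed.

(** Both sides equal
[⊓(w_n ∘ m_r) ∘ i ∘ ⊓(Phi ∘ T_r e) ∘ i ∘ ⊓e], where [w_n] is [lact_pow] and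
[e] stands for peeling: on the left the module axiom of [i] produces the two
copies of [i]; on the right they come from the two rotations, the [i] applied
last being moved before the [w_n] of the other rotation by naturality. *)
Lemma sept_rot_insm0 n :
  sept_rot A Y n ∘ fmap G (insm T n 0 (N Y))
    = fmap G (insm T n n (N Y)) ∘ sept_rot A Y n.+1 ∘ sept_rot A Y n.+1.
Proof.
rewrite !sept_rotE; set y := N Y; set e := peel_fpow T; set w := lact_pow N Y.
have ins_e : e n y ∘ insm T n 0 y
    = mmul T (fpow T n y) ∘ fmap T (e n y) ∘ e n.+1 y by exact: peel_insm0.
have peel_w : e n.+1 y ∘ w n.+1
    = fmap T (w n) ∘ Phi A (fpow T n y) ∘ fmap R (e n y) by exact: peel_lact_pow.
have mul_w : w n ∘ mmul R (fpow T n y)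
    = insm T n n y ∘ w n.+1 ∘ fmap R (w n) by exact: lact_pow_mul.
(* Keeps reassociation from unfolding [w] into its own factors. *)
clearbody e w.
transitivity (fmap G (w n ∘ mmul R (fpow T n y)) ∘ ract G (R (fpow T n y))
  ∘ fmap G (Phi A (fpow T n y) ∘ fmap R (e n y)) ∘ ract G (fpow T n.+1 y)
  ∘ fmap G (e n.+1 y)).
- rewrite -[LHS]compmA -(fmapM G) ins_e !(fmapM G) !compmA.
  rewrite -[X in X ∘ _ ∘ _ = _]compmA (ract_mul G) !compmA.
  by congr (_ ∘ _); rewrite -!compmA ract_nat.
rewrite mul_w !compmA; congr (_ ∘ _ ∘ _).
rewrite -[RHS]compmA -[X in _ = _ ∘ X](fmapM G) peel_w.
rewrite -(compmA (fmap T (w n))) (fmapM G (fmap T (w n))) [RHS]compmA.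
by congr (_ ∘ _); rewrite -[RHS]compmA ract_nat !compmA -!(fmapM G).
Qed.

Lemma sept_cosimplicial : is_cosimplicial (sept_data A Y).
Proof.
split=> n /=.
- move=> i j le_ij; rewrite !sept_cofaceE -!fmapM; congr (fmap G _).
  exact: insu_insu (leq_ord j).
- move=> i j le_ij; rewrite !sept_codegE -!fmapM; congr (fmap G _).
  exact: insm_insm (leq_ord j).
- move=> i j le_ij; rewrite sept_codegE !sept_cofaceE sept_codegE -!fmapM.
  congr (fmap G _); exact: insm_insu_lt (leq_ord j).
- move=> j; rewrite sept_codegE sept_cofaceE -fmapM -fmap1; congr (fmap G _).
  exact: insm_insu_eq (leq_ord j).
- move=> j; rewrite sept_codegE sept_cofaceE -fmapM -fmap1; congr (fmap G _).
  exact: insm_insu_succ (leq_ord j).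
- move=> i j lt_ji; rewrite sept_codegE !sept_cofaceE sept_codegE -!fmapM.
  congr (fmap G _); exact: insm_insu_gt (leq_ord i).
Qed.
End ParaCocyclicObject.

(** * Functoriality *)

Section Functoriality.
Variables (D M C : category) (A : septuple D M C).

Lemma sept_paracocyclic (Y : D) : is_paracocyclic (sept_data A Y).
Proof.
split=> [|n|n k|n|[|n] k] /=; first exact: sept_cosimplicial.
- rewrite !sept_cofaceE; exact: sept_rot_insu0.
- rewrite !sept_cofaceE; exact: sept_rot_insu (leq_ord k).
- rewrite !sept_codegE; exact: sept_rot_insm0.
- by case: k.
- rewrite !sept_codegE; exact: sept_rot_insm (leq_ord k).
Qed.

Lemma sept_map_rot (Y Y' : D) (f : hom Y Y') n :
  sept_map A f n ∘ sept_rot A Y n = sept_rot A Y' n ∘ sept_map A f n.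
Proof.
rewrite !sept_rotE /sept_map -[RHS]compmA -(fmapM (sqcap A)) peel_fpow_nat.
rewrite (fmapM (sqcap A)) [RHS]compmA -[X in _ = X ∘ _]compmA ract_nat.
by rewrite !compmA -!(fmapM (sqcap A)) lact_pow_nat.
Qed.

Lemma sept_map_pcmor (Y Y' : D) (f : hom Y Y') :
  is_pcmor (Z := sept_data A Y) (Z' := sept_data A Y') (sept_map A f).
Proof.
split=> n /=; last exact: sept_map_rot.
- move=> k; rewrite !sept_cofaceE /sept_map -!(fmapM (sqcap A)).
  congr (fmap (sqcap A) _); exact: insu_nat (leq_ord k).
- move=> k; rewrite !sept_codegE /sept_map -!(fmapM (sqcap A)).
  congr (fmap (sqcap A) _); exact: insm_nat (leq_ord k).
Qed.
End Functoriality.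

Theorem corollary2p4 (D M C : category) (A : septuple D M C) :
  exists (Hob : forall Y : D, is_paracocyclic (sept_data A Y))
         (Hmor : forall (Y Y' : D) (f : hom Y Y'),
            is_pcmor (Z := sept_data A Y) (Z' := sept_data A Y') (sept_map A f))
         (F : functor D (paracocyclic C)),
    fdata F =
      @Prefunctor D (paracocyclic C)
        (fun Y => PCObj (Hob Y))
        (fun Y Y' f =>
           @PCMor C (PCObj (Hob Y)) (PCObj (Hob Y')) (sept_map A f) (Hmor Y Y' f)).
Proof.
exists (sept_paracocyclic A), (sept_map_pcmor A).
set F := Prefunctor _.
have F1 Y : fmap F (idm Y) = idm (F Y).
  by apply: pcmor_eq => n; rewrite /= /sept_map !fmap1.
have FM X Y Z (g : hom Y Z) (f : hom X Y) :
    fmap F (g ∘ f) = fmap F g ∘ fmap F f.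
  by apply: pcmor_eq => n; rewrite /= /sept_map !fmapM.
by exists (Functor F1 FM).
Qed.
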